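(* Let $f\colon[0,1]\to[0,1]$ be continuous and topologically mixing with $f(0)=0$. Then there exist $\varepsilon>0$ and a dense Mycielski set $S\subset[0,1]$ such that $S\cup\{0\}$ is syndetically $\varepsilon$-scrambled for $f$.
   Context: Mixing: for all nonempty open $U,V$, $\{m: f^m(U)\cap V\ne\emptyset\}$ is cofinite. Syndetic: subset of $\mathbb N$ meeting every set with arbitrarily long runs of consecutive integers. A set with at least two points is syndetically $\varepsilon$-scrambled for $f$ if for every distinct $x,y$ in it: $\{m:|f^mx-f^my|<\eta\}$ is syndetic for every $\eta>0$, $|f^mx-f^my|\not\to0$, and $\limsup_m|f^mx-f^my|\ge\varepsilon$. Mycielski set: countable union of Cantor sets. *)

(* Defs.v *)
From Stdlib Require Import Reals Lra Lia.
Open Scope R_scope.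

Definition I01 (x : R) : Prop := 0 <= x <= 1.

Fixpoint iter (f : R -> R) (m : nat) (x : R) : R :=
  match m with O => x | S k => f (iter f k x) end.

Definition maps_I01 (f : R -> R) : Prop := forall x, I01 x -> I01 (f x).

Definition continuous_on_I01 (f : R -> R) : Prop :=
  forall x, I01 x -> forall eps, eps > 0 ->
    exists delta, delta > 0 /\
      forall y, I01 y -> Rabs (y - x) < delta -> Rabs (f y - f x) < eps.

Definition open_in_I01 (U : R -> Prop) : Prop :=
  (forall x, U x -> I01 x) /\
  forall x, U x -> exists d, d > 0 /\ forall y, I01 y -> Rabs (y - x) < d -> U y.

Definition mixing (f : R -> R) : Prop :=
  forall U V : R -> Prop, open_in_I01 U -> open_in_I01 V ->
    (exists u, U u) -> (exists v, V v) ->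
    exists N : nat, forall m : nat, (N <= m)%nat ->
      exists x, U x /\ V (iter f m x).

Definition thick (B : nat -> Prop) : Prop :=
  forall L : nat, exists n : nat, forall k : nat, (k < L)%nat -> B (n + k)%nat.

Definition syndetic (A : nat -> Prop) : Prop :=
  forall B, thick B -> exists m, A m /\ B m.

Definition synd_scrambled (f : R -> R) (eps : R) (S : R -> Prop) : Prop :=
  (exists x y, S x /\ S y /\ x <> y) /\
  forall x y, S x -> S y -> x <> y ->
    (forall eta, eta > 0 ->
       syndetic (fun m => Rabs (iter f m x - iter f m y) < eta)) /\
    ~ Un_cv (fun m => Rabs (iter f m x - iter f m y)) 0 /\
    (forall delta, delta > 0 -> forall N : nat, exists m : nat,
       (N <= m)%nat /\ Rabs (iter f m x - iter f m y) > eps - delta).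

(* Cantor space 2^N with the product topology; a Cantor set in R is a set
   homeomorphic to it, i.e. the image of a continuous injection (a continuous
   injection from the compact space 2^N into R is a homeomorphism onto its image). *)
Definition cantor_set (C : R -> Prop) : Prop :=
  exists h : (nat -> bool) -> R,
    (forall s eps, eps > 0 -> exists n : nat, forall t : nat -> bool,
        (forall k, (k < n)%nat -> t k = s k) -> Rabs (h t - h s) < eps) /\
    (forall s t, h s = h t -> s = t) /\
    (forall x, C x <-> exists s, h s = x).

Definition mycielski (S : R -> Prop) : Prop :=
  exists Cs : nat -> (R -> Prop),
    (forall n, cantor_set (Cs n)) /\
    (forall x, S x <-> exists n, Cs n x).

Definition dense_in_I01 (S : R -> Prop) : Prop :=
  (forall x, S x -> I01 x) /\
  forall x eps, I01 x -> eps > 0 -> exists s, S s /\ Rabs (s - x) < eps.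

(* Main.v *)
(** By mixing, no interval [[0, x]] or [[x, 1]] with [0 < x < 1] is invariant.  Hence there
    are intervals [D_k], contained in [[0, 1/(k+2)]], such that [D_k] covers [D_(k+1)] and
    [D_(k+1)] covers [D_k] under iterates of [f] whose orbits stay in [[0, 1/(k+2)]]
    meanwhile.  If some interior point is eventually mapped to the fixed point 0, then
    [D_k = [0, 1/(k+2)]] works; otherwise [f > 0] off 0 and [D_k = [c_k, 1/(k+2)]] works
    for small [c_k > 0].  An orbit that repeatedly travels
    [D_0 -> B -> D_0 -> D_1 -> ... -> D_i -> ... -> D_0], with [i] growing and [B] one of two
    fixed separated intervals away from 0, visits each [[0, 1/(k+2)]] with gaps depending on
    [k] only, so it is syndetically proximal to 0.  By continuity at 0, two such orbits are
    then syndetically proximal to each other.  The choices of [B], made at times common to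
    all orbits, code a sequence of bits in which every index recurs; so distinct sequences
    give orbits separated by 1/4 infinitely often.  The points with a prescribed code in a
    given interval are intersections of nested intervals, which shrink by mixing, and
    therefore depend continuously on the code. *)

Require Import Defs.
From Stdlib Require Import Reals Lra Lia ClassicalEpsilon FunctionalExtensionality Cantor.
Open Scope R_scope.

(** * Continuous functions on the unit interval *)

(** Precomposition with this retraction extends a function continuous on the unit interval to all of
    R, so that the standard theorems on continuous functions apply. *)
Definition clamp (x : R) : R := Rmax 0 (Rmin 1 x).

Lemma clamp_I01 x : I01 (clamp x).
Proof. unfold I01, clamp, Rmax, Rmin; repeat destruct (Rle_dec _ _); lra. Qed.

Lemma clamp_id x : I01 x -> clamp x = x.
Proof. unfold I01, clamp, Rmax, Rmin; intros; repeat destruct (Rle_dec _ _); lra. Qed.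

Lemma clamp_contracting x y : Rabs (clamp x - clamp y) <= Rabs (x - y).
Proof.
  unfold clamp, Rmax, Rmin, Rabs; repeat destruct (Rle_dec _ _);
    repeat destruct (Rcase_abs _); lra.
Qed.

Lemma continuity_clamp g : continuous_on_I01 g -> continuity (fun x => g (clamp x)).
Proof.
  intros Hg x eps Heps.
  destruct (Hg (clamp x) (clamp_I01 x) eps Heps) as [d [Hd H]].
  exists d; split; [exact Hd|]. intros y [_ Hy]. simpl in *. unfold Rdist in *.
  apply H; [apply clamp_I01|].
  apply Rle_lt_trans with (2 := Hy), clamp_contracting.
Qed.

Lemma IVT_I01 g a b y :
  continuous_on_I01 g -> 0 <= a -> a <= b -> b <= 1 ->
  (g a <= y <= g b \/ g b <= y <= g a) ->
  exists z, a <= z <= b /\ g z = y.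
Proof.
  intros Hg Ha Hab Hb Hy.
  destruct (IVT_cor (fun x => g (clamp x) - y) a b) as [z [Hz Ez]]; auto.
  - apply (continuity_minus (fun x => g (clamp x)) (fct_cte y)).
    + now apply continuity_clamp.
    + apply continuity_const. now intros u v.
  - rewrite !clamp_id by (unfold I01; lra). nra.
  - exists z; split; [exact Hz|]. rewrite clamp_id in Ez by (unfold I01; lra). lra.
Qed.

Lemma IVT_between g a b u v y :
  continuous_on_I01 g -> 0 <= a -> b <= 1 -> a <= u <= b -> a <= v <= b ->
  g u <= y <= g v -> exists z, a <= z <= b /\ g z = y.
Proof.
  intros Hg Ha Hb Hu Hv Hy.
  destruct (Rle_dec u v) as [H|H].
  - destruct (IVT_I01 g u v y) as [z [Hz Ez]]; auto; try lra.
    exists z; split; [lra|exact Ez].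
  - destruct (IVT_I01 g v u y) as [z [Hz Ez]]; auto; try lra.
    exists z; split; [lra|exact Ez].
Qed.

Lemma attains_max g a b :
  continuous_on_I01 g -> 0 <= a -> a <= b -> b <= 1 ->
  exists x, a <= x <= b /\ forall y, a <= y <= b -> g y <= g x.
Proof.
  intros Hg Ha Hab Hb.
  destruct (continuity_ab_maj (fun x => g (clamp x)) a b Hab) as [x [H Hx]].
  - intros c _. apply continuity_clamp, Hg.
  - exists x; split; [exact Hx|]. intros y Hy. specialize (H y Hy).
    now rewrite !clamp_id in H by (unfold I01; lra).
Qed.

Lemma attains_min g a b :
  continuous_on_I01 g -> 0 <= a -> a <= b -> b <= 1 ->
  exists x, a <= x <= b /\ forall y, a <= y <= b -> g x <= g y.
Proof.
  intros Hg Ha Hab Hb.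
  destruct (continuity_ab_min (fun x => g (clamp x)) a b Hab) as [x [H Hx]].
  - intros c _. apply continuity_clamp, Hg.
  - exists x; split; [exact Hx|]. intros y Hy. specialize (H y Hy).
    now rewrite !clamp_id in H by (unfold I01; lra).
Qed.

(** The point is the supremum of the [x] in [[u, v]] with [g x <= c]. *)
Lemma last_crossing g u v c :
  continuous_on_I01 g -> 0 <= u -> u <= v -> v <= 1 -> g u <= c <= g v ->
  exists a, u <= a <= v /\ g a = c /\ forall x, a <= x <= v -> c <= g x.
Proof.
  intros Hg Hu Huv Hv Hc.
  destruct (completeness (fun x => u <= x <= v /\ g x <= c)) as [a [Hub Hlub]].
  - exists v. intros x [Hx _]; lra.
  - exists u. lra.
  - assert (Hua : u <= a) by (apply Hub; lra).
    assert (Hav : a <= v) by (apply Hlub; intros x [Hx _]; lra).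
    assert (Hgt : forall x, a < x <= v -> c < g x).
    { intros x Hx. destruct (Rlt_dec c (g x)) as [|n]; auto.
      assert (x <= a) by (apply Hub; lra). lra. }
    assert (Hle : g a <= c).
    { destruct (Rle_dec (g a) c) as [|n]; auto.
      destruct (Hg a ltac:(unfold I01; lra) (g a - c) ltac:(lra)) as [d [Hd Hcont]].
      (* If [g a > c], then [g > c] near [a], so this maximum bounds the set; hence [a = u], where
         [g u <= c]. *)
      assert (a <= Rmax u (a - d / 2)); [|unfold Rmax in *; destruct (Rle_dec _ _)].
      - apply Hlub. intros x [Hx Hxc].
        assert (x <= a) by (apply Hub; lra).
        destruct (Rle_dec x (a - d / 2)) as [|m].
        + apply Rle_trans with (2 := Rmax_r _ _); lra.
        + specialize (Hcont x ltac:(unfold I01; lra) ltac:(apply Rabs_def1; lra)).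
          apply Rabs_def2 in Hcont. lra.
      - lra.
      - assert (a = u) by lra. subst a. lra. }
    assert (Hge : c <= g a).
    { destruct (Rle_dec a v) as [|n]; [|lra]. destruct (Req_dec a v) as [->|Ne]; [lra|].
      destruct (Rle_dec c (g a)) as [|n]; auto.
      destruct (Hg a ltac:(unfold I01; lra) (c - g a) ltac:(lra)) as [d [Hd Hcont]].
      pose (x := Rmin v (a + d / 2)).
      assert (a < x <= v /\ x <= a + d / 2)
        by (unfold x, Rmin; destruct (Rle_dec _ _); lra).
      specialize (Hcont x ltac:(unfold I01; lra) ltac:(apply Rabs_def1; lra)).
      apply Rabs_def2 in Hcont. specialize (Hgt x ltac:(lra)). lra. }
    exists a; repeat split; try lra.
    intros x Hx. destruct (Req_dec a x) as [<-|Ne]; [lra|].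
    apply Rlt_le, Hgt; lra.
Qed.

Lemma continuous_opp g : continuous_on_I01 g -> continuous_on_I01 (fun x => - g x).
Proof.
  intros Hg x Hx eps Heps. destruct (Hg x Hx eps Heps) as [d [Hd H]].
  exists d; split; auto. intros y Hy Hxy.
  replace (- g y - - g x) with (- (g y - g x)) by ring. rewrite Rabs_Ropp. auto.
Qed.

Lemma continuous_flip g : continuous_on_I01 g -> continuous_on_I01 (fun x => g (1 - x)).
Proof.
  intros Hg x Hx eps Heps.
  destruct (Hg (1 - x) ltac:(unfold I01 in *; lra) eps Heps) as [d [Hd H]].
  exists d; split; auto. intros y Hy Hxy. apply H; [unfold I01 in *; lra|].
  replace (1 - y - (1 - x)) with (- (y - x)) by ring. now rewrite Rabs_Ropp.
Qed.

(** The reflection [x -> 1 - x] together with a change of sign turns a last crossing into a first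
    one. *)
Lemma first_crossing g u v c :
  continuous_on_I01 g -> 0 <= u -> u <= v -> v <= 1 -> g u <= c <= g v ->
  exists b, u <= b <= v /\ g b = c /\ forall x, u <= x <= b -> g x <= c.
Proof.
  intros Hg Hu Huv Hv Hc.
  destruct (last_crossing (fun x => - g (1 - x)) (1 - v) (1 - u) (- c))
    as [a [Ha [Ea H]]]; try lra.
  - now apply continuous_opp, continuous_flip.
  - replace (1 - (1 - v)) with v by ring. replace (1 - (1 - u)) with u by ring. lra.
  - exists (1 - a); repeat split; try lra.
    intros x Hx. specialize (H (1 - x) ltac:(lra)).
    replace (1 - (1 - x)) with x in H by ring. lra.
Qed.

(** Between the last crossing of [c] and the first crossing of [d] after it, the values cannot leave
    [[c, d]]. *)
Lemma tight_subinterval_incr g u v c d :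
  continuous_on_I01 g -> 0 <= u -> u <= v -> v <= 1 -> c <= d -> g u <= c -> d <= g v ->
  exists a b, u <= a /\ a <= b /\ b <= v /\ g a = c /\ g b = d /\
    forall x, a <= x <= b -> c <= g x <= d.
Proof.
  intros Hg Hu Huv Hv Hcd Hc Hd.
  destruct (last_crossing g u v c) as [a [Ha [Ea Ga]]]; auto; try lra.
  destruct (first_crossing g a v d) as [b [Hb [Eb Gb]]]; auto; try lra.
  exists a, b; repeat split; try lra.
  - apply Ga; lra.
  - apply Gb; lra.
Qed.

(** The order of [u] and [v] is not known; if [v] comes first, the increasing case applies to
    [- g]. *)
Lemma tight_subinterval g a b u v c d :
  continuous_on_I01 g -> 0 <= a -> b <= 1 -> a <= u <= b -> a <= v <= b ->
  c <= d -> g u <= c -> d <= g v ->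
  exists a' b', a <= a' /\ a' <= b' /\ b' <= b /\
    (forall x, a' <= x <= b' -> c <= g x <= d) /\
    (forall y, c <= y <= d -> exists x, a' <= x <= b' /\ g x = y).
Proof.
  intros Hg Ha Hb Hu Hv Hcd Hc Hd.
  destruct (Rle_dec u v) as [Huv|Hvu].
  - destruct (tight_subinterval_incr g u v c d)
      as [p [q [Hp [Hpq [Hq [Ep [Eq H]]]]]]]; auto; try lra.
    exists p, q; repeat split; try lra; try (apply H; lra).
    intros y Hy. apply (IVT_I01 g p q y); auto; lra.
  - destruct (tight_subinterval_incr (fun x => - g x) v u (- d) (- c))
      as [p [q [Hp [Hpq [Hq [Ep [Eq H]]]]]]]; auto; try lra.
    { now apply continuous_opp. }
    exists p, q; repeat split; try lra; try (specialize (H x ltac:(lra)); lra).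
    intros y Hy. apply (IVT_I01 g p q y); auto; lra.
Qed.

(** Let [s] be the supremum of the points satisfying [P]. Some such point lies within [d] of [s],
    and the step from it would pass [s] unless [q'] is reached. As [P] may fail at [s] itself, the
    step has to start from any nearby point not beyond [s]. *)
Lemma interval_induction (P : R -> Prop) q q' :
  q <= q' -> P q ->
  (forall s, q <= s <= q' -> exists d, d > 0 /\
     forall x, q <= x -> s - d < x <= s -> P x -> P (Rmin (s + d) q')) ->
  P q'.
Proof.
  intros Hq P0 Hstep.
  destruct (completeness (fun x => q <= x <= q' /\ P x)) as [s [Hub Hlub]].
  - exists q'. intros x [Hx _]; lra.
  - exists q. split; [lra|exact P0].
  - assert (Hqs : q <= s) by (apply Hub; split; [lra|exact P0]).
    assert (Hsq : s <= q') by (apply Hlub; intros x [Hx _]; lra).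
    destruct (Hstep s ltac:(lra)) as [d [Hd H]].
    destruct (classic (exists x, q <= x /\ s - d < x <= s /\ P x)) as [[x [Hx [Hxs Px]]]|N].
    + specialize (H x Hx Hxs Px).
      assert (Rmin (s + d) q' <= s).
      { apply Hub. split; [|exact H]. unfold Rmin; destruct (Rle_dec _ _); lra. }
      unfold Rmin in *; destruct (Rle_dec _ _); [lra|exact H].
    + assert (s <= s - d); [|lra].
      apply Hlub. intros x [Hx Px].
      destruct (Rle_dec x (s - d)) as [|n]; auto.
      exfalso. apply N. exists x. repeat split; try lra; auto.
Qed.

(** * Interval coverings *)

Section MixingMap.

Context (f : R -> R) (f_maps : maps_I01 f) (f_cont : continuous_on_I01 f)
  (f_mixing : mixing f) (f0 : f 0 = 0).

Lemma iter_add n m x : iter f (m + n) x = iter f m (iter f n x).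
Proof. induction m as [|m IH]; simpl; [reflexivity|now rewrite IH]. Qed.

Lemma iter_I01 n x : I01 x -> I01 (iter f n x).
Proof. intros Hx. induction n as [|n IH]; simpl; auto. Qed.

Lemma iter_fixed0 n : iter f n 0 = 0.
Proof. induction n as [|n IH]; simpl; [reflexivity|now rewrite IH]. Qed.

Lemma continuous_iter n : continuous_on_I01 (iter f n).
Proof.
  induction n as [|n IH]; intros x Hx eps Heps.
  - exists eps. split; auto.
  - destruct (f_cont (iter f n x) (iter_I01 n x Hx) eps Heps) as [e [He H]].
    destruct (IH x Hx e He) as [d [Hd H']].
    exists d. split; auto. intros y Hy Hxy. simpl. apply H; auto using iter_I01.
Qed.

(* Every closed subinterval [K] of [[c, d]] is exactly the image under [f^n] of
   some closed subinterval of [[a, b]] all of whose points satisfy [P].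
   Quantifying over [K] is what makes the notion compose. *)
Definition covers (a b : R) (n : nat) (c d : R) (P : R -> Prop) : Prop :=
  forall c' d', c <= c' -> c' <= d' -> d' <= d ->
    exists a' b', a <= a' /\ a' <= b' /\ b' <= b /\
      (forall x, a' <= x <= b' -> c' <= iter f n x <= d' /\ P x) /\
      (forall y, c' <= y <= d' -> exists x, a' <= x <= b' /\ iter f n x = y).

(** A subinterval of the last interval is pulled back through the second covering, and the result
    through the first. *)
Lemma covers_trans a b n c d P m e g Q S :
  covers a b n c d P -> covers c d m e g Q ->
  (forall x, a <= x <= b -> c <= iter f n x <= d -> e <= iter f (m + n) x <= g ->
     P x -> Q (iter f n x) -> S x) ->
  covers a b (m + n) e g S.
Proof.
  intros H1 H2 HS e' g' He Heg Hg.
  destruct (H2 e' g' He Heg Hg) as [c' [d' [Hc' [Hcd' [Hd' [Hin' Hon']]]]]].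
  destruct (H1 c' d' Hc' Hcd' Hd') as [a' [b' [Ha' [Hab' [Hb' [Hin Hon]]]]]].
  exists a', b'. repeat split; auto.
  - rewrite iter_add. now apply Hin', Hin.
  - rewrite iter_add. now apply Hin', Hin.
  - destruct (Hin x H) as [Hx Px]. destruct (Hin' _ Hx) as [Hx' Qx].
    apply HS; auto; try rewrite iter_add; lra.
  - intros y Hy. destruct (Hon' y Hy) as [z [Hz <-]]. destruct (Hon z Hz) as [x [Hx <-]].
    exists x; split; [exact Hx|apply iter_add].
Qed.

(** Intermediate value criterion: one value at most [c] and one at least [d] suffice for a
    covering. *)
Lemma covers_values a b n c d u v (P : R -> Prop) :
  0 <= a -> b <= 1 -> a <= u <= b -> a <= v <= b ->
  iter f n u <= c -> d <= iter f n v ->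
  (forall x, a <= x <= b -> c <= iter f n x <= d -> P x) ->
  covers a b n c d P.
Proof.
  intros Ha Hb Hu Hv Hc Hd HP c' d' Hc' Hcd' Hd'.
  destruct (tight_subinterval (iter f n) a b u v c' d')
    as [a' [b' [Ha' [Hab' [Hb' [Hin Hon]]]]]]; auto using continuous_iter; try lra.
  exists a', b'. repeat split; auto; try (apply Hin; assumption).
  specialize (Hin x H). apply HP; lra.
Qed.

Lemma covers_sub a b n c d c1 d1 P :
  covers a b n c d P -> c <= c1 -> d1 <= d -> covers a b n c1 d1 P.
Proof. intros H Hc Hd c' d' Hc' Hcd' Hd'. apply H; lra. Qed.

Lemma covers_weaken a b n c d (P Q : R -> Prop) :
  covers a b n c d P -> (forall x, P x -> Q x) -> covers a b n c d Q.
Proof.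
  intros H HPQ c' d' Hc' Hcd' Hd'.
  destruct (H c' d' Hc' Hcd' Hd') as [a' [b' [Ha' [Hab' [Hb' [Hin Hon]]]]]].
  exists a', b'. repeat split; auto; try (apply Hin; assumption).
  now apply HPQ, Hin.
Qed.

Lemma covers_refl a b (P : R -> Prop) : (forall x, a <= x <= b -> P x) -> covers a b 0 a b P.
Proof.
  intros HP c' d' Hc Hcd Hd. exists c', d'. repeat split; simpl; try lra.
  - apply HP; lra.
  - intros y Hy. exists y; auto.
Qed.

Definition stays (q : R) (n : nat) (x : R) : Prop :=
  forall t, (t <= n)%nat -> iter f t x <= q.

Lemma covers_stays_trans a b n c d m e g q :
  covers a b n c d (stays q n) -> covers c d m e g (stays q m) ->
  covers a b (m + n) e g (stays q (m + n)).
Proof.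
  intros H1 H2. apply covers_trans with (1 := H1) (2 := H2).
  intros x _ _ _ Hn Hm t Ht.
  destruct (Nat.le_gt_cases t n) as [Htn|Htn]; [now apply Hn|].
  replace t with ((t - n) + n)%nat by lia. rewrite iter_add. apply Hm. lia.
Qed.

(** * Consequences of mixing *)

Lemma open_below x : open_in_I01 (fun y => I01 y /\ y < x).
Proof.
  split; [tauto|]. intros y [Hy Hyx]. exists (x - y). split; [lra|].
  intros z Hz Hd. apply Rabs_def2 in Hd. split; auto; lra.
Qed.

Lemma open_above x : open_in_I01 (fun y => I01 y /\ x < y).
Proof.
  split; [tauto|]. intros y [Hy Hyx]. exists (y - x). split; [lra|].
  intros z Hz Hd. apply Rabs_def2 in Hd. split; auto; lra.
Qed.

Lemma open_between a b : open_in_I01 (fun y => I01 y /\ a < y < b).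
Proof.
  split; [tauto|]. intros y [Hy Hyx]. exists (Rmin (y - a) (b - y)). split.
  - unfold Rmin; destruct (Rle_dec _ _); lra.
  - intros z Hz Hd. apply Rabs_def2 in Hd. unfold Rmin in Hd.
    destruct (Rle_dec _ _); split; auto; lra.
Qed.

Lemma eventually_above a b d :
  0 <= a -> a < b -> b <= 1 -> d < 1 ->
  exists N, forall m, (N <= m)%nat -> exists x, a < x < b /\ d < iter f m x.
Proof.
  intros Ha Hab Hb Hd.
  destruct (f_mixing _ _ (open_between a b) (open_above d)) as [N H].
  - exists ((a + b) / 2). unfold I01; lra.
  - exists 1. unfold I01; lra.
  - exists N. intros m Hm. destruct (H m Hm) as [x [[_ Hx] [_ Hy]]]. now exists x.
Qed.

Lemma eventually_below a b c :
  0 <= a -> a < b -> b <= 1 -> 0 < c ->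
  exists N, forall m, (N <= m)%nat -> exists x, a < x < b /\ iter f m x < c.
Proof.
  intros Ha Hab Hb Hd.
  destruct (f_mixing _ _ (open_between a b) (open_below c)) as [N H].
  - exists ((a + b) / 2). unfold I01; lra.
  - exists 0. unfold I01; lra.
  - exists N. intros m Hm. destruct (H m Hm) as [x [[_ Hx] [_ Hy]]]. now exists x.
Qed.

(** For all large [m], mixing gives points of [[a, b]] sent into [[0, c)] and [(d, 1]], which are
    nonempty open sets as [0 < c] and [d < 1]. *)
Lemma eventually_covers a b c d :
  0 <= a -> a < b -> b <= 1 -> 0 < c -> d < 1 ->
  exists N, forall m, (N <= m)%nat -> covers a b m c d (fun _ => True).
Proof.
  intros Ha Hab Hb Hc Hd.
  destruct (eventually_below a b c) as [N1 H1]; auto.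
  destruct (eventually_above a b d) as [N2 H2]; auto.
  exists (Nat.max N1 N2). intros m Hm.
  destruct (H1 m ltac:(lia)) as [u [Hu Hu']]. destruct (H2 m ltac:(lia)) as [v [Hv Hv']].
  apply covers_values with (u := u) (v := v); auto; lra.
Qed.

(** Otherwise [[0, x]] would be invariant, and no iterate could carry a point of it above [x]. *)
Lemma escapes_up x : 0 < x < 1 -> exists y, 0 <= y <= x /\ x < f y.
Proof.
  intros Hx. apply NNPP. intros N.
  assert (H : forall n y, 0 <= y <= x -> 0 <= iter f n y <= x).
  { induction n as [|n IH]; intros y Hy; simpl; auto.
    specialize (IH y Hy). split.
    - apply f_maps. unfold I01; lra.
    - destruct (Rle_dec (f (iter f n y)) x) as [|n']; auto.
      exfalso. apply N. exists (iter f n y). lra. }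
  destruct (eventually_above 0 x x) as [M HM]; try lra.
  destruct (HM M (le_n _)) as [y [Hy Hy']]. specialize (H M y ltac:(lra)). lra.
Qed.

Lemma escapes_down x : 0 < x < 1 -> exists y, x <= y <= 1 /\ f y < x.
Proof.
  intros Hx. apply NNPP. intros N.
  assert (H : forall n y, x <= y <= 1 -> x <= iter f n y <= 1).
  { induction n as [|n IH]; intros y Hy; simpl; auto.
    specialize (IH y Hy). split.
    - destruct (Rle_dec x (f (iter f n y))) as [|n']; auto.
      exfalso. apply N. exists (iter f n y). lra.
    - apply f_maps. unfold I01; lra. }
  destruct (eventually_below x 1 x) as [M HM]; try lra.
  destruct (HM M (le_n _)) as [y [Hy Hy']]. specialize (H M y ltac:(lra)). lra.
Qed.

(** A maximum of [f] below 1 would bound all iterates from the first on, against mixing. *)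
Lemma attains_one : exists x, I01 x /\ f x = 1.
Proof.
  destruct (attains_max f 0 1) as [x [Hx H]]; auto; try lra.
  exists x. split; [exact Hx|].
  destruct (Req_dec (f x) 1) as [|Ne]; auto. exfalso.
  pose proof (f_maps x Hx) as Hfx. unfold I01 in Hfx.
  destruct (eventually_above 0 1 (f x)) as [N HN]; try lra.
  destruct (HN (S N) ltac:(lia)) as [y [Hy Hy']]. simpl in Hy'.
  specialize (H (iter f N y)). pose proof (iter_I01 N y ltac:(unfold I01; lra)) as Hi.
  specialize (H Hi). lra.
Qed.

(** * Moving between neighbourhoods of the fixed point *)

(** The right end is pushed from [q] to [q'] by interval induction: one more application of [f]
    sends [y0] to the left of [c] or onto it, and another point beyond the right end reached so far.
    Only points with image at most [q'] are kept. *)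
Lemma covers_grow_up c q q' :
  0 <= c -> c < q -> q <= q' -> q' <= 1 ->
  (exists y, c <= y <= q /\ f y <= c) ->
  (forall x, q <= x <= q' -> exists y, c <= y <= x /\ x < f y) ->
  exists n, covers c q n c q' (stays q' n).
Proof.
  intros Hc Hcq Hqq Hq [y0 [Hy0 Hf0]] Hup.
  apply (interval_induction (fun x => exists n, covers c q n c x (stays q' n)) q q' Hqq).
  - exists 0%nat. apply covers_refl. intros x Hx t Ht.
    replace t with 0%nat by lia. simpl; lra.
  - intros s Hs. destruct (Hup s Hs) as [y [Hy Hfy]].
    destruct (f_cont y ltac:(unfold I01; lra) ((f y - s) / 2) ltac:(lra)) as [e [He Hcont]].
    (* Half of the excess [f y - s] is left for the advance, the other half absorbs the variation of
       [f] near [y]. *)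
    exists (Rmin e ((f y - s) / 2)). split.
    { unfold Rmin; destruct (Rle_dec _ _); lra. }
    intros x Hqx Hxs [n Hn].
    set (d := Rmin e ((f y - s) / 2)) in *.
    assert (Hd : d <= e /\ d <= (f y - s) / 2) by (unfold d, Rmin; destruct (Rle_dec _ _); lra).
    set (g := Rmin (s + d) q').
    assert (Hg : g <= s + d /\ g <= q') by (unfold g, Rmin; destruct (Rle_dec _ _); lra).
    (* The point [y] found for [s] may lie beyond [x]; then [x] is close enough to [y] to replace
       it. *)
    assert (Hv : exists v, c <= v <= x /\ g <= f v).
    { destruct (Rle_dec y x) as [Hyx|Hyx].
      - exists y. lra.
      - exists x. split; [lra|].
        specialize (Hcont x ltac:(unfold I01; lra) ltac:(apply Rabs_def1; lra)).
        apply Rabs_def2 in Hcont. lra. }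
    destruct Hv as [v [Hv Hfv]].
    exists (1 + n)%nat. apply covers_stays_trans with (1 := Hn).
    apply covers_values with (u := y0) (v := v); simpl; try lra.
    intros z Hz Hfz t Ht. destruct t as [|[|t]]; simpl; [lra|lra|lia].
Qed.

(** Mirror image of the upward growth: the interval induction runs over the negated left end. *)
Lemma covers_grow_down c c' q :
  0 <= c' -> c' <= c -> c < q -> q <= 1 ->
  (exists y, c <= y <= q /\ q <= f y) ->
  (forall x, c' <= x <= c -> exists y, x <= y <= q /\ f y < x) ->
  exists n, covers c q n c' q (stays q n).
Proof.
  intros Hc' Hcc Hcq Hq [y0 [Hy0 Hf0]] Hdown.
  cut (exists n, covers c q n (- (- c')) q (stays q n)).
  { now rewrite Ropp_involutive. }
  apply (interval_induction (fun x => exists n, covers c q n (- x) q (stays q n)) (- c) (- c'));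
    [lra| |].
  - rewrite Ropp_involutive. exists 0%nat. apply covers_refl. intros x Hx t Ht.
    replace t with 0%nat by lia. simpl; lra.
  - intros s Hs. destruct (Hdown (- s) ltac:(lra)) as [y [Hy Hfy]].
    destruct (f_cont y ltac:(unfold I01; lra) ((- s - f y) / 2) ltac:(lra)) as [e [He Hcont]].
    exists (Rmin e ((- s - f y) / 2)). split.
    { unfold Rmin; destruct (Rle_dec _ _); lra. }
    intros x Hqx Hxs [n Hn].
    set (d := Rmin e ((- s - f y) / 2)) in *.
    assert (Hd : d <= e /\ d <= (- s - f y) / 2) by (unfold d, Rmin; destruct (Rle_dec _ _); lra).
    set (g := Rmin (s + d) (- c')).
    assert (Hg : g <= s + d /\ g <= - c') by (unfold g, Rmin; destruct (Rle_dec _ _); lra).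
    assert (Hv : exists v, - x <= v <= q /\ f v <= - g).
    { destruct (Rle_dec (- x) y) as [Hyx|Hyx].
      - exists y. lra.
      - exists (- x). split; [lra|].
        specialize (Hcont (- x) ltac:(unfold I01; lra) ltac:(apply Rabs_def1; lra)).
        apply Rabs_def2 in Hcont. lra. }
    destruct Hv as [v [Hv Hfv]].
    exists (1 + n)%nat. apply covers_stays_trans with (1 := Hn).
    apply covers_values with (u := v) (v := y0); simpl; try lra.
    intros z Hz Hfz t Ht. destruct t as [|[|t]]; simpl; [lra|lra|lia].
Qed.

(** * The ladder of intervals descending to 0 *)

Definition level (k : nat) : R := / INR (S (S k)).

Lemma level_pos k : 0 < level k.
Proof. apply Rinv_0_lt_compat, lt_0_INR. lia. Qed.

Lemma level_decr j k : (j <= k)%nat -> level k <= level j.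
Proof.
  intros H. apply Rinv_le_contravar; [apply lt_0_INR; lia|]. apply le_INR. lia.
Qed.

Lemma level_lt1 k : level k < 1.
Proof.
  apply Rle_lt_trans with (level 0); [apply level_decr; lia|].
  unfold level; simpl; lra.
Qed.

Lemma level_small eta : 0 < eta -> exists k, level k < eta.
Proof.
  intros H. destruct (archimed_cor1 eta H) as [N [HN HN0]]. exists N.
  apply Rle_lt_trans with (2 := HN). apply Rinv_le_contravar; [now apply lt_0_INR|].
  apply le_INR. lia.
Qed.

(** The intervals [[lo k, level k]] are the rungs [D_k]. Moves between rungs [k] and [k + 1], in
    both directions, stay below [level k]. The last clause lets any interval return to the first
    rung at every late time. *)
Definition ladder (lo : nat -> R) : Prop :=
  (forall k, 0 <= lo k < level k) /\
  (forall k, exists n,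
     covers (lo k) (level k) n (lo (S k)) (level (S k)) (stays (level k) n)) /\
  (forall k, exists n,
     covers (lo (S k)) (level (S k)) n (lo k) (level k) (stays (level k) n)) /\
  (forall a b, 0 <= a -> a < b -> b <= 1 ->
     exists N, forall m, (N <= m)%nat -> covers a b m (lo 0%nat) (level 0) (fun _ => True)).

(** The rungs are nested, so descending takes no time, and the fixed point 0 anchors the ascent. To
    hit 0 exactly at time [m], the orbit passes through [z] at time [m - j]. *)
Lemma ladder_accessible z j : 0 < z < 1 -> iter f j z = 0 -> ladder (fun _ => 0).
Proof.
  intros Hz Hj. split; [|split; [|split]].
  - intros k. pose proof (level_pos k). lra.
  - intros k. exists 0%nat. apply covers_sub with (c := 0) (d := level k).
    + apply covers_refl. intros x Hx t Ht. replace t with 0%nat by lia. simpl; lra.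
    + lra.
    + apply level_decr; lia.
  - intros k. pose proof (level_pos (S k)). pose proof (level_lt1 k).
    pose proof (level_decr k (S k) ltac:(lia)).
    apply covers_grow_up; try lra.
    + exists 0. lra.
    + intros x Hx. apply escapes_up; lra.
  - intros a b Ha Hab Hb. pose proof (level_lt1 0) as L.
    destruct (eventually_below a b z) as [N1 H1]; try lra.
    destruct (eventually_above a b z) as [N2 H2]; try lra.
    destruct (eventually_above a b (level 0)) as [N3 H3]; try lra.
    exists (Nat.max (Nat.max N1 N2 + j) N3). intros m Hm.
    destruct (H1 (m - j)%nat ltac:(lia)) as [u [Hu Eu]].
    destruct (H2 (m - j)%nat ltac:(lia)) as [v [Hv Ev]].
    destruct (H3 m ltac:(lia)) as [y [Hy Ey]].
    destruct (IVT_between (iter f (m - j)) a b u v z) as [x [Hx Ex]];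
      auto using continuous_iter; try lra.
    assert (E0 : iter f m x = 0).
    { replace m with (j + (m - j))%nat by lia. now rewrite iter_add, Ex. }
    apply covers_values with (u := x) (v := y); auto; lra.
Qed.

(* If [f > 0] off the fixed point, then [f] is bounded below on [[q, 1]], so once
   [c] is small the points leaving [[c, 1]] downwards do so from within [[c, q]]. *)
Lemma two_sided_growth q :
  (forall y, 0 < y <= 1 -> 0 < f y) -> 0 < q < 1 ->
  exists c, 0 < c < q /\ forall c', 0 < c' <= c ->
    (exists y, c' <= y <= q /\ f y < c') /\
    (forall x, q <= x < 1 -> exists y, c' <= y <= x /\ x < f y).
Proof.
  intros Hpos Hq.
  destruct (attains_min f q 1) as [x0 [Hx0 Hmin]]; auto; try lra.
  pose proof (Hpos x0 ltac:(lra)) as Hm.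
  destruct (f_cont 0 ltac:(unfold I01; lra) q ltac:(lra)) as [d [Hd Hcont]].
  (* The bound [q / 2] keeps [c] below [q]; the minimum [f x0] on [[q, 1]] forces points sent below
     [c'] to lie left of [q]; and [d / 2] ensures that points left of [c'] are not sent above
     [q]. *)
  exists (Rmin (q / 2) (Rmin (f x0) (d / 2))).
  set (c := Rmin (q / 2) (Rmin (f x0) (d / 2))).
  assert (Hc : 0 < c /\ c <= q / 2 /\ c <= f x0 /\ c <= d / 2).
  { unfold c, Rmin; repeat destruct (Rle_dec _ _); lra. }
  split; [lra|]. intros c' Hc'. split.
  - destruct (escapes_down c') as [y [Hy Hfy]]; [lra|].
    exists y. split; [|exact Hfy]. split; [lra|].
    destruct (Rle_dec y q) as [|n]; auto. specialize (Hmin y ltac:(lra)). lra.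
  - intros x Hx. destruct (escapes_up x) as [y [Hy Hfy]]; [lra|].
    exists y. split; [|exact Hfy]. split; [|lra].
    destruct (Rle_dec c' y) as [|n]; auto.
    specialize (Hcont y ltac:(unfold I01; lra) ltac:(apply Rabs_def1; lra)).
    rewrite f0 in Hcont. apply Rabs_def2 in Hcont. lra.
Qed.

(** Descending enlarges rung [k] to the left until it contains rung [k + 1]. Ascending first
    enlarges rung [k + 1] to the left, then to the right up to [level k]. *)
Lemma ladder_inaccessible :
  (forall y, 0 < y <= 1 -> 0 < f y) -> exists lo, ladder lo.
Proof.
  intros Hpos.
  assert (Hex : forall k, exists c, 0 < c < level k /\ forall c', 0 < c' <= c ->
    (exists y, c' <= y <= level k /\ f y < c') /\
    (forall x, level k <= x < 1 -> exists y, c' <= y <= x /\ x < f y)).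
  { intros k. apply two_sided_growth; auto. split; [apply level_pos|apply level_lt1]. }
  pose (lo := fun k => proj1_sig (constructive_indefinite_description _ (Hex k))).
  assert (Hlo : forall k, 0 < lo k < level k /\ forall c', 0 < c' <= lo k ->
    (exists y, c' <= y <= level k /\ f y < c') /\
    (forall x, level k <= x < 1 -> exists y, c' <= y <= x /\ x < f y)).
  { intros k. exact (proj2_sig (constructive_indefinite_description _ (Hex k))). }
  clearbody lo. clear Hex. exists lo.
  assert (Hdown : forall k c, 0 < c <= lo k -> exists n,
    covers (lo k) (level k) n c (level k) (stays (level k) n)).
  { intros k c Hc. destruct (Hlo k) as [Hk H]. pose proof (level_lt1 k).
    apply covers_grow_down; try lra.
    - destruct (H (lo k) ltac:(lra)) as [_ Hup].
      destruct (Hup (level k) ltac:(lra)) as [y Hy]. exists y; lra.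
    - intros x Hx. destruct (H x ltac:(lra)) as [Hd _]. exact Hd. }
  split; [|split; [|split]].
  - intros k. destruct (Hlo k). lra.
  - intros k. pose proof (level_decr k (S k) ltac:(lia)).
    destruct (Hlo k) as [Hk _]. destruct (Hlo (S k)) as [Hk' _].
    destruct (Hdown k (Rmin (lo k) (lo (S k)))) as [n Hn].
    { unfold Rmin; destruct (Rle_dec _ _); lra. }
    exists n. apply covers_sub with (1 := Hn); [apply Rmin_r|lra].
  - intros k. pose proof (level_decr k (S k) ltac:(lia)) as Hl. pose proof (level_lt1 k).
    destruct (Hlo k) as [Hk _]. destruct (Hlo (S k)) as [Hk' H'].
    (* The sequence [lo] is not known to be monotone, so a lower end common to both rungs is
       taken. *)
    set (c := Rmin (lo k) (lo (S k))).
    assert (Hc : 0 < c /\ c <= lo k /\ c <= lo (S k))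
      by (unfold c, Rmin; destruct (Rle_dec _ _); lra).
    destruct (Hdown (S k) c) as [n Hn]; [lra|].
    destruct (H' c ltac:(lra)) as [[y Hy] Hup].
    destruct (covers_grow_up c (level (S k)) (level k)) as [m Hm]; try lra.
    + exists y; lra.
    + intros x Hx. apply Hup; lra.
    + exists (m + n)%nat. apply covers_sub with (c := c) (d := level k); try lra.
      apply covers_stays_trans with (2 := Hm).
      apply covers_weaken with (1 := Hn). intros x Hx t Ht.
      apply Rle_trans with (2 := Hl). now apply Hx.
  - intros a b Ha Hab Hb. apply eventually_covers; auto.
    + apply Hlo.
    + apply level_lt1.
Qed.

Lemma ladder_exists : exists lo, ladder lo.
Proof.
  destruct (classic (exists z j, 0 < z < 1 /\ iter f j z = 0)) as [[z [j [Hz Hj]]]|N].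
  - exists (fun _ => 0). now apply ladder_accessible with z j.
  - apply ladder_inaccessible. intros y Hy.
    destruct (f_maps y ltac:(unfold I01; lra)) as [[Hf|Hf] _]; auto.
    (* If [f 1 = 0], a preimage of 1 is an interior point, and it reaches 0 in two steps. *)
    exfalso. apply N. destruct (Req_dec y 1) as [->|Hy1].
    + destruct attains_one as [x [Hx Ex]]. exists x, 2%nat. simpl.
      rewrite Ex. split; [|lra]. unfold I01 in Hx.
      assert (x <> 0) by (intros ->; lra). assert (x <> 1) by (intros ->; lra). lra.
    + exists y, 1%nat. simpl. split; lra.
Qed.

(** * Itineraries *)

Fixpoint total (d : nat -> nat) (k : nat) : nat :=
  match k with O => O | S j => (d j + total d j)%nat end.

Lemma total_le d j k : (j <= k)%nat -> (total d j <= total d k)%nat.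
Proof. induction 1; simpl; lia. Qed.

(** The two intervals are [1/4] apart, at distance at least [1/4] from 0, and inside [(0, 1)], where
    mixing provides coverings. *)
Definition target (beta : bool) (x : R) : Prop :=
  if beta then 5/8 <= x <= 3/4 else 1/4 <= x <= 3/8.

Lemma target_bounds beta x : target beta x -> 1/4 <= x <= 3/4.
Proof. destruct beta; simpl; lra. Qed.

Lemma target_separated beta gamma x y :
  beta <> gamma -> target beta x -> target gamma y -> 1/4 <= Rabs (x - y).
Proof.
  destruct beta, gamma; simpl; intros N Hx Hy; try congruence;
    unfold Rabs; destruct (Rcase_abs _); lra.
Qed.

(** The predicate records that after rung [k] is reached, at time [total d k], the orbit stays below
    [level k]. *)
Lemma covers_descent lo d i :
  (forall k, 0 <= lo k < level k) ->
  (forall k, covers (lo k) (level k) (d k) (lo (S k)) (level (S k)) (stays (level k) (d k))) ->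
  covers (lo 0%nat) (level 0) (total d i) (lo i) (level i)
    (fun x => forall k t, (k <= i)%nat -> (total d k <= t)%nat -> (t <= total d i)%nat ->
       iter f t x <= level k).
Proof.
  intros Hlo Hd. induction i as [|i IH].
  - apply covers_refl. intros x Hx k t Hk _ Ht.
    replace k with 0%nat by lia. replace t with 0%nat by (simpl in Ht; lia). simpl; lra.
  - apply covers_trans with (1 := IH) (2 := Hd i).
    intros x Hx Hi Hi' HP HQ k t Hk Hkt Ht. simpl in Ht.
    destruct (Nat.eq_dec k (S i)) as [->|Nk].
    + replace t with (d i + total d i)%nat by (simpl in Hkt; lia). lra.
    + destruct (Nat.le_gt_cases t (total d i)) as [Hti|Hti]; [apply HP; auto; lia|].
      replace t with ((t - total d i) + total d i)%nat by lia. rewrite iter_add.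
      apply Rle_trans with (level i); [apply HQ; lia|apply level_decr; lia].
Qed.

(** Time is counted back from the end: the climb from rung [k] takes [total e k] whatever the
    starting rung [i] is. *)
Lemma covers_ascent lo e i :
  (forall k, 0 <= lo k < level k) ->
  (forall k, covers (lo (S k)) (level (S k)) (e k) (lo k) (level k) (stays (level k) (e k))) ->
  covers (lo i) (level i) (total e i) (lo 0%nat) (level 0)
    (fun x => forall k t, (k <= i)%nat -> (t + total e k <= total e i)%nat ->
       iter f t x <= level k).
Proof.
  intros Hlo He. induction i as [|i IH].
  - apply covers_refl. intros x Hx k t Hk Ht. simpl in Ht.
    replace k with 0%nat by lia. replace t with 0%nat by lia. simpl; lra.
  - simpl. rewrite Nat.add_comm. apply covers_trans with (1 := He i) (2 := IH).
    intros x Hx Hi Hi' HP HQ k t Hk Ht.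
    destruct (Nat.eq_dec k (S i)) as [->|Nk].
    + simpl in Ht. replace t with 0%nat by lia. simpl; lra.
    + destruct (Nat.le_gt_cases t (e i)) as [Hti|Hti].
      * apply Rle_trans with (level i); [apply HP; lia|apply level_decr; lia].
      * replace t with ((t - e i) + e i)%nat by lia. rewrite iter_add. apply HQ; lia.
Qed.

Definition stage_path (b : nat) (pre post : nat -> nat) (i : nat) (beta : bool) (x : R) : Prop :=
  target beta (iter f b x) /\
  forall k t, (k <= i)%nat -> (pre k <= t)%nat -> (t + post k <= pre i + post i)%nat ->
    iter f t x <= level k.

(* A stage starts and ends in the home interval [[h0, h1]]: it visits the target of
   the given bit, then goes down to level [i] and back up.  The time [pre k] of
   reaching level [k] and the time [post k] left after leaving it do not depend on
   [i]; this is what yields bounded gaps. *)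
Lemma stages_exist :
  exists h0 h1 b pre post,
    0 <= h0 /\ h0 < h1 /\ h1 <= 1 /\ (0 < pre 0)%nat /\
    (forall j k, (j <= k)%nat -> (pre j <= pre k)%nat /\ (post j <= post k)%nat) /\
    (forall u v, 0 <= u -> u < v -> v <= 1 ->
       exists N, forall m, (N <= m)%nat -> covers u v m h0 h1 (fun _ => True)) /\
    (forall i beta, covers h0 h1 (pre i + post i) h0 h1 (stage_path b pre post i beta)).
Proof.
  destruct ladder_exists as [lo [Hlo [Hdown [Hup Hhit]]]].
  set (d := fun k => proj1_sig (constructive_indefinite_description _ (Hdown k))).
  assert (Hd : forall k,
    covers (lo k) (level k) (d k) (lo (S k)) (level (S k)) (stays (level k) (d k)))
    by (intros k; exact (proj2_sig (constructive_indefinite_description _ (Hdown k)))).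
  set (e := fun k => proj1_sig (constructive_indefinite_description _ (Hup k))).
  assert (He : forall k,
    covers (lo (S k)) (level (S k)) (e k) (lo k) (level k) (stays (level k) (e k)))
    by (intros k; exact (proj2_sig (constructive_indefinite_description _ (Hup k)))).
  clearbody d e. clear Hdown Hup.
  pose proof (Hlo 0%nat) as H0. pose proof (level_lt1 0) as L0.
  destruct (eventually_covers (lo 0%nat) (level 0) (1/4) (3/4)) as [b Hb]; try lra.
  specialize (Hb b (le_n _)).
  destruct (Hhit (1/4) (3/8)) as [N1 H1]; try lra.
  destruct (Hhit (5/8) (3/4)) as [N2 H2]; try lra.
  (* One return time serves both targets, so the length of a stage does not depend on the bit; the
     successor makes it positive. *)
  set (b' := S (Nat.max N1 N2)).
  specialize (H1 b' ltac:(lia)). specialize (H2 b' ltac:(lia)).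
  assert (Hround : forall beta, covers (lo 0%nat) (level 0) (b' + b) (lo 0%nat) (level 0)
    (fun x => target beta (iter f b x))).
  { intros [|].
    - apply covers_trans with (c := 5/8) (d := 3/4) (P := fun _ => True) (2 := H2).
      + apply covers_sub with (1 := Hb); lra.
      + now intros x _ Hx _ _ _.
    - apply covers_trans with (c := 1/4) (d := 3/8) (P := fun _ => True) (2 := H1).
      + apply covers_sub with (1 := Hb); lra.
      + now intros x _ Hx _ _ _. }
  set (pre := fun k => (total d k + (b' + b))%nat).
  exists (lo 0%nat), (level 0), b, pre, (total e).
  repeat split; try lra.
  - unfold pre, b'; simpl; lia.
  - unfold pre. pose proof (total_le d j k H). lia.
  - now apply total_le.
  - intros u v Hu Huv Hv. now apply Hhit.
  - intros i beta. rewrite Nat.add_comm.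
    assert (Hthere : covers (lo 0%nat) (level 0) (pre i) (lo i) (level i)
      (fun x => target beta (iter f b x) /\ forall k t, (k <= i)%nat -> (pre k <= t)%nat ->
        (t <= pre i)%nat -> iter f t x <= level k)).
    { apply covers_trans with (1 := Hround beta) (2 := covers_descent lo d i Hlo Hd).
      intros x _ _ _ Hx HQ. split; [exact Hx|]. intros k t Hk Hkt Ht. unfold pre in *.
      replace t with ((t - (b' + b)) + (b' + b))%nat by lia. rewrite iter_add.
      apply HQ; lia. }
    apply covers_trans with (1 := Hthere) (2 := covers_ascent lo e i Hlo He).
    intros x _ _ _ [Hx HP] HQ. split; [exact Hx|]. intros k t Hk Hkt Ht.
    destruct (Nat.le_gt_cases t (pre i)) as [Hti|Hti]; [apply HP; auto|].
    replace t with ((t - pre i) + pre i)%nat by lia. rewrite iter_add. apply HQ; lia.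
Qed.

(** * Points with a prescribed itinerary *)

(** The supremum of the left ends works. With [eps = 0] this gives a common point, with [eps > 0] a
    common nondegenerate interval. *)
Lemma nested_intervals (l r : nat -> R) eps :
  (forall j, l j <= l (S j)) -> (forall j, r (S j) <= r j) -> (forall j, l j + eps <= r j) ->
  exists x, forall j, l j <= x /\ x + eps <= r j.
Proof.
  intros Hl Hr Hlr.
  assert (Hl' : forall j k, (j <= k)%nat -> l j <= l k)
    by (induction 1 as [|k _ IH]; [lra|specialize (Hl k); lra]).
  assert (Hr' : forall j k, (j <= k)%nat -> r k <= r j)
    by (induction 1 as [|k _ IH]; [lra|specialize (Hr k); lra]).
  assert (Hlr' : forall j k, l k + eps <= r j).
  { intros j k. pose proof (Hl' k (Nat.max j k) ltac:(lia)).
    pose proof (Hr' j (Nat.max j k) ltac:(lia)). specialize (Hlr (Nat.max j k)). lra. }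
  destruct (completeness (fun y => exists j, y = l j)) as [x [Hub Hlub]].
  - exists (r 0%nat - eps). intros y [j ->]. specialize (Hlr' 0%nat j). lra.
  - now exists (l 0%nat), 0%nat.
  - exists x. intros j. split; [apply Hub; now exists j|].
    assert (x <= r j - eps); [|lra].
    apply Hlub. intros y [k ->]. specialize (Hlr' j k). lra.
Qed.

(* Stage [i] carries the bit of index [idx i]; every index occurs infinitely often. *)
Definition idx (i : nat) : nat := fst (of_nat i).

Lemma idx_le i : (idx i <= i)%nat.
Proof.
  unfold idx. pose proof (cancel_to_of i) as E. destruct (of_nat i) as [x y]; simpl.
  pose proof (to_nat_non_decreasing x y). lia.
Qed.

Lemma idx_recurs j n : exists i, (n <= i)%nat /\ idx i = j.
Proof.
  exists (to_nat (j, n)). unfold idx. rewrite cancel_of_to. split; [|reflexivity].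
  pose proof (to_nat_non_decreasing j n). lia.
Qed.

Fixpoint nodes {A : Type} (step : nat -> bool -> A -> A) (p : A) (i0 : nat)
  (w : nat -> bool) (j : nat) : A :=
  match j with
  | O => p
  | S k => step (i0 + k)%nat (w (idx (i0 + k))) (nodes step p i0 w k)
  end.

(** Stage [i] reads the bit of index [idx i <= i], so finitely many bits determine a node;
    continuity in the code rests on this. *)
Lemma nodes_prefix {A : Type} (step : nat -> bool -> A -> A) p i0 w w' j :
  (forall k, (k < i0 + j)%nat -> w' k = w k) -> nodes step p i0 w' j = nodes step p i0 w j.
Proof.
  intros H. induction j as [|j IH]; simpl; [reflexivity|].
  rewrite IH by (intros k Hk; apply H; lia).
  rewrite H; [reflexivity|]. pose proof (idx_le (i0 + j)). lia.
Qed.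

Section Itineraries.

Context (h0 h1 : R) (b : nat) (pre post : nat -> nat)
  (h0_pos : 0 <= h0) (h0_h1 : h0 < h1) (h1_le1 : h1 <= 1) (pre0 : (0 < pre 0)%nat)
  (pre_post_mono : forall j k, (j <= k)%nat -> (pre j <= pre k)%nat /\ (post j <= post k)%nat)
  (home_hit : forall u v, 0 <= u -> u < v -> v <= 1 ->
     exists N, forall m, (N <= m)%nat -> covers u v m h0 h1 (fun _ => True))
  (home_stage : forall i beta,
     covers h0 h1 (pre i + post i) h0 h1 (stage_path b pre post i beta)).

(** Stage lengths are independent of the bits, so these times are common to all orbits. *)
Definition start : nat -> nat := total (fun i => pre i + post i)%nat.

Lemma start_ge i : (i <= start i)%nat.
Proof.
  induction i as [|i IH]; unfold start in *; simpl; [lia|].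
  destruct (pre_post_mono 0 i ltac:(lia)). lia.
Qed.

Definition tight (i : nat) (p : R * R) : Prop :=
  0 <= fst p /\ fst p <= snd p /\ snd p <= 1 /\
  (forall x, fst p <= x <= snd p -> h0 <= iter f (start i) x <= h1) /\
  (forall y, h0 <= y <= h1 -> exists x, fst p <= x <= snd p /\ iter f (start i) x = y).

(** The covering by one stage yields a subinterval of the home interval, which is then pulled back
    into [p]. Tightness is assumed inside the existential so that choice gives a step function
    defined on all pairs. *)
Lemma tight_step i beta p : exists p', tight i p ->
  tight (S i) p' /\ fst p <= fst p' /\ snd p' <= snd p /\
  forall x, fst p' <= x <= snd p' -> stage_path b pre post i beta (iter f (start i) x).
Proof.
  destruct (classic (tight i p)) as [T|NT]; [|exists p; tauto].
  destruct p as [l r]. destruct T as [Hl [Hlr [Hr [Hin Hon]]]]. simpl in *.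
  destruct (home_stage i beta h0 h1) as [c [d [Hc [Hcd [Hd [Hin' Hon']]]]]]; try lra.
  destruct (Hon c) as [u [Hu Eu]]; [lra|]. destruct (Hon d) as [v [Hv Ev]]; [lra|].
  destruct (tight_subinterval (iter f (start i)) l r u v c d)
    as [l' [r' [Hl' [Hlr' [Hr' [Hin2 Hon2]]]]]]; auto using continuous_iter; try lra.
  exists (l', r'). unfold tight. simpl.
  assert (Es : forall x, iter f (start (S i)) x
    = iter f (pre i + post i) (iter f (start i) x)) by (intros x; now rewrite <- iter_add).
  intros _. repeat split; try lra.
  - rewrite Es. now apply Hin', Hin2.
  - rewrite Es. now apply Hin', Hin2.
  - intros y Hy. destruct (Hon' y Hy) as [z [Hz <-]]. destruct (Hon2 z Hz) as [x [Hx <-]].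
    exists x. auto.
  - now apply Hin', Hin2.
  - now apply Hin', Hin2.
Qed.

Lemma itinerary_points u v :
  0 <= u -> u < v -> v <= 1 ->
  exists (i0 : nat) (pt : (nat -> bool) -> R),
    (forall w, u <= pt w <= v) /\
    (forall w i, (i0 <= i)%nat ->
       stage_path b pre post i (w (idx i)) (iter f (start i) (pt w))) /\
    (forall w eps, eps > 0 -> exists n, forall w',
       (forall k, (k < n)%nat -> w' k = w k) -> Rabs (pt w' - pt w) < eps).
Proof.
  intros Hu Huv Hv. destruct (home_hit u v Hu Huv Hv) as [i0 Hi0].
  (* The covering is available from time [i0] on, hence at [start i0 >= i0]; the itinerary begins
     with stage [i0]. *)
  destruct (Hi0 (start i0) (start_ge i0) h0 h1) as [l [r [Hl [Hlr [Hr [Hin Hon]]]]]]; try lra.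
  pose (step := fun i beta p =>
    proj1_sig (constructive_indefinite_description _ (tight_step i beta p))).
  assert (Hstep : forall i beta p, tight i p ->
    tight (S i) (step i beta p) /\ fst p <= fst (step i beta p) /\
    snd (step i beta p) <= snd p /\
    forall x, fst (step i beta p) <= x <= snd (step i beta p) ->
      stage_path b pre post i beta (iter f (start i) x)).
  { intros i beta p.
    exact (proj2_sig (constructive_indefinite_description _ (tight_step i beta p))). }
  clearbody step.
  set (K := nodes step (l, r) i0).
  assert (HT : forall w j, tight (i0 + j) (K w j)).
  { intros w j. induction j as [|j IH].
    - rewrite Nat.add_0_r. repeat split; simpl; try lra; try (apply Hin; assumption); auto.
    - rewrite Nat.add_succ_r. now apply Hstep. }
  assert (Hmono : forall w j, fst (K w j) <= fst (K w (S j)) /\ snd (K w (S j)) <= snd (K w j)).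
  { intros w j. destruct (Hstep (i0 + j)%nat (w (idx (i0 + j))) (K w j) (HT w j))
      as [_ [H1 [H2 _]]]. now split. }
  assert (Hst : forall w i x, (i0 <= i)%nat ->
    (forall j, fst (K w j) <= x <= snd (K w j)) ->
    stage_path b pre post i (w (idx i)) (iter f (start i) x)).
  { intros w i x Hi Hx. replace i with (i0 + (i - i0))%nat by lia.
    destruct (Hstep (i0 + (i - i0))%nat (w (idx (i0 + (i - i0)))) (K w (i - i0)%nat)
      (HT w (i - i0)%nat)) as [_ [_ [_ H]]].
    apply H, (Hx (S (i - i0))). }
  assert (Hex : forall w, exists x, forall j, fst (K w j) <= x <= snd (K w j)).
  { intros w. destruct (nested_intervals (fun j => fst (K w j)) (fun j => snd (K w j)) 0)
      as [x Hx]; try (intros j; apply Hmono).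
    - intros j. destruct (HT w j) as [_ [H _]]. lra.
    - exists x. intros j. specialize (Hx j). lra. }
  (* A nondegenerate limit interval would eventually be stretched above 3/4, whereas
     all its points stay in the targets at the target times. *)
  assert (Hshrink : forall w eps, eps > 0 -> exists j, snd (K w j) - fst (K w j) < eps).
  { intros w eps Heps. apply NNPP. intros N.
    destruct (nested_intervals (fun j => fst (K w j)) (fun j => snd (K w j)) eps)
      as [x Hx]; try (intros j; apply Hmono).
    - intros j. destruct (Rle_dec (fst (K w j) + eps) (snd (K w j))) as [|n]; auto.
      exfalso. apply N. exists j. lra.
    - destruct (eventually_above x (x + eps) (3/4)) as [M HM]; try lra.
      + destruct (HT w 0%nat) as [H _]. specialize (Hx 0%nat). lra.
      + destruct (HT w 0%nat) as [_ [_ [H _]]]. specialize (Hx 0%nat). lra.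
      + destruct (HM (b + start (i0 + M))%nat) as [y [Hy Hy']].
        { pose proof (start_ge (i0 + M)). lia. }
        rewrite iter_add in Hy'.
        destruct (Hst w (i0 + M)%nat y) as [Ht _]; [lia| |].
        * intros j. specialize (Hx j). lra.
        * apply target_bounds in Ht. lra. }
  exists i0, (fun w => proj1_sig (constructive_indefinite_description _ (Hex w))).
  assert (Hpt : forall w j,
    fst (K w j) <= proj1_sig (constructive_indefinite_description _ (Hex w)) <= snd (K w j))
    by (intros w; exact (proj2_sig (constructive_indefinite_description _ (Hex w)))).
  split; [|split].
  - intros w. specialize (Hpt w 0%nat). simpl in Hpt. simpl. lra.
  - intros w i Hi. apply Hst; auto.
  - intros w eps Heps. destruct (Hshrink w eps Heps) as [j Hj].
    (* Codes agreeing on the first [i0 + j] bits share the node [j], whose length is less than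
       [eps]. *)
    exists (i0 + j)%nat. intros w' Hw.
    pose proof (Hpt w j) as H1. pose proof (Hpt w' j) as H2.
    replace (K w' j) with (K w j) in H2 by (symmetry; now apply nodes_prefix).
    apply Rabs_def1; lra.
Qed.


(** * Syndetic proximality *)

(** Bounded gaps are used instead of thick sets because the bound [G] fixes how long another orbit
    has to remain near 0. *)
Definition syndetically_small (x : R) : Prop :=
  forall eta, eta > 0 -> exists G, forall m, exists m',
    (m <= m' <= m + G)%nat /\ iter f m' x < eta.

(** The stages partition the times, each having positive length by [0 < pre 0]. *)
Lemma stage_of m i1 : (start i1 <= m)%nat ->
  exists i, (i1 <= i)%nat /\ (start i <= m < start (S i))%nat.
Proof.
  assert (Hlt : forall i, (start i < start (S i))%nat).
  { intros i. unfold start; simpl. destruct (pre_post_mono 0 i ltac:(lia)). lia. }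
  intros H. induction H as [|m H IH].
  - exists i1. auto.
  - destruct IH as [i [Hi Hm]]. destruct (Nat.eq_dec (S m) (start (S i))) as [E|E].
    + exists (S i). specialize (Hlt (S i)). lia.
    + exists i. lia.
Qed.

Lemma stage_paths_small w x i0 :
  (forall i, (i0 <= i)%nat -> stage_path b pre post i (w i) (iter f (start i) x)) ->
  syndetically_small x.
Proof.
  intros Hx eta Heta. destruct (level_small eta Heta) as [k Hk].
  set (i1 := Nat.max i0 k).
  assert (Hvisit : forall i t, (i1 <= i)%nat -> (pre k <= t)%nat ->
    (t + post k <= pre i + post i)%nat -> iter f (t + start i) x < eta).
  { intros i t Hi Hkt Ht. rewrite iter_add. apply Rle_lt_trans with (2 := Hk).
    apply (Hx i ltac:(lia)); auto. lia. }
  assert (Hfirst : forall i, (i1 <= i)%nat -> iter f (pre k + start i) x < eta).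
  { intros i Hi. apply Hvisit; auto. destruct (pre_post_mono k i ltac:(lia)). lia. }
  (* At worst one waits out the last [post k] steps of a stage and the first [pre k] steps of the
     next; [start i1] accounts for the times before stage [i1]. *)
  exists (pre k + post k + start i1)%nat. intros m.
  destruct (Nat.le_gt_cases (start i1) m) as [Hm|Hm].
  - destruct (stage_of m i1 Hm) as [i [Hi Him]].
    assert (Es : start (S i) = (pre i + post i + start i)%nat) by reflexivity.
    destruct (Nat.le_gt_cases (pre k + start i) m) as [H1|H1].
    + destruct (Nat.le_gt_cases (m - start i + post k) (pre i + post i)) as [H2|H2].
      * exists m. split; [lia|]. replace m with ((m - start i) + start i)%nat by lia.
        apply Hvisit; lia.
      * exists (pre k + start (S i))%nat. split; [lia|]. apply Hfirst; lia.
    + exists (pre k + start i)%nat. split; [lia|]. now apply Hfirst.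
  - exists (pre k + start i1)%nat. split; [lia|]. now apply Hfirst.
Qed.

End Itineraries.

Lemma bounded_gaps_syndetic (A : nat -> Prop) G :
  (forall m, exists m', (m <= m' <= m + G)%nat /\ A m') -> syndetic A.
Proof.
  intros H B HB. destruct (HB (S G)) as [n Hn]. destruct (H n) as [m [Hm Am]].
  exists m. split; [exact Am|]. replace m with (n + (m - n))%nat by lia. apply Hn. lia.
Qed.

(** Each of the finitely many iterates up to [G] is continuous at the fixed point 0. *)
Lemma small_for_long eta G : eta > 0 ->
  exists d, d > 0 /\ forall y, I01 y -> y < d ->
    forall i, (i <= G)%nat -> iter f i y < eta.
Proof.
  intros Heta. induction G as [|G [d [Hd IH]]].
  - exists eta. split; [exact Heta|]. intros y _ Hy i Hi. now replace i with 0%nat by lia.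
  - destruct (continuous_iter (S G) 0 ltac:(unfold I01; lra) eta Heta) as [e [He H]].
    exists (Rmin d e). split; [unfold Rmin; destruct (Rle_dec _ _); lra|].
    intros y Hy Hyd i Hi.
    assert (y < d /\ y < e) by (unfold Rmin in Hyd; destruct (Rle_dec _ _); lra).
    destruct (Nat.eq_dec i (S G)) as [->|Ne].
    + specialize (H y Hy). rewrite iter_fixed0 in H. unfold I01 in Hy.
      specialize (H ltac:(apply Rabs_def1; lra)). apply Rabs_def2 in H. lra.
    + apply IH; auto; try lia; lra.
Qed.

(* A syndetic visit of [x] to a small enough neighbourhood of 0 starts a stay near 0
   longer than the gaps between the visits of [y]. *)
Lemma small_pair_syndetic x y eta :
  I01 x -> I01 y -> syndetically_small x -> syndetically_small y -> eta > 0 ->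
  syndetic (fun m => Rabs (iter f m x - iter f m y) < eta).
Proof.
  intros Hx Hy Sx Sy Heta. destruct (Sy eta Heta) as [G HG].
  destruct (small_for_long eta G Heta) as [d [Hd Hlong]].
  destruct (Sx d Hd) as [G' HG'].
  apply bounded_gaps_syndetic with (G' + G)%nat. intros m.
  destruct (HG' m) as [m1 [Hm1 Hxd]]. destruct (HG m1) as [m2 [Hm2 Hye]].
  exists m2. split; [lia|].
  pose proof (Hlong (iter f m1 x) (iter_I01 m1 x Hx) Hxd (m2 - m1)%nat ltac:(lia)) as Hxe.
  rewrite <- iter_add in Hxe. replace (m2 - m1 + m1)%nat with m2 in Hxe by lia.
  pose proof (iter_I01 m2 x Hx). pose proof (iter_I01 m2 y Hy). unfold I01 in *.
  apply Rabs_def1; lra.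
Qed.

Lemma syndetically_small_0 : syndetically_small 0.
Proof.
  intros eta Heta. exists 0%nat. intros m. exists m. split; [lia|].
  now rewrite iter_fixed0.
Qed.

End MixingMap.

(** * Coding *)

(** The position of the first [false] encodes [n], so distinct pairs [(n, s)] have distinct codes
    and points from different cells are also separated. *)
Definition word (n : nat) (s : nat -> bool) (j : nat) : bool :=
  if (j <? n)%nat then true else if (j =? n)%nat then false else s (j - S n)%nat.

Lemma word_before n s j : (j < n)%nat -> word n s j = true.
Proof. intros H. unfold word. now rewrite (proj2 (Nat.ltb_lt j n) H). Qed.

Lemma word_at n s : word n s n = false.
Proof. unfold word. now rewrite Nat.ltb_irrefl, Nat.eqb_refl. Qed.

Lemma word_after n s j : word n s (S n + j) = s j.
Proof.
  unfold word. rewrite (proj2 (Nat.ltb_ge _ _)) by lia.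
  rewrite (proj2 (Nat.eqb_neq _ _)) by lia. f_equal. lia.
Qed.

Lemma word_inj n s n' s' :
  (forall j, word n s j = word n' s' j) -> n = n' /\ s = s'.
Proof.
  intros H. assert (n = n') as <-.
  { destruct (Nat.lt_trichotomy n n') as [L|[E|L]]; auto; exfalso.
    - specialize (H n). rewrite word_at, word_before in H by auto. discriminate.
    - specialize (H n'). rewrite word_at, word_before in H by auto. discriminate. }
  split; [reflexivity|]. apply functional_extensionality. intros j.
  now rewrite <- (word_after n s j), <- (word_after n s' j), H.
Qed.

Lemma word_prefix n s s' m :
  (forall k, (k < m)%nat -> s' k = s k) ->
  forall k, (k < m)%nat -> word n s' k = word n s k.
Proof.
  intros H k Hk. unfold word.
  destruct (k <? n)%nat, (k =? n)%nat; auto. apply H. lia.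
Qed.

(** An enumeration of uniform grids of all mesh sizes [1/(q+1)]; each cell will receive one Cantor
    set. Pairs with [p > q] would leave the unit interval and default to [[0, 1]]. *)
Definition cell (n : nat) : R * R :=
  let (p, q) := of_nat n in
  if (p <=? q)%nat then (INR p / INR (S q), INR (S p) / INR (S q)) else (0, 1).

Lemma cell_I01 n : 0 <= fst (cell n) /\ fst (cell n) < snd (cell n) /\ snd (cell n) <= 1.
Proof.
  unfold cell. destruct (of_nat n) as [p q].
  destruct (Nat.leb_spec p q) as [H|H]; cbn [fst snd]; [|lra].
  assert (Hq : 0 < INR (S q)) by (apply lt_0_INR; lia).
  repeat split.
  - apply Rmult_le_pos; [apply pos_INR|]. now apply Rlt_le, Rinv_0_lt_compat.
  - apply Rmult_lt_compat_r; [now apply Rinv_0_lt_compat|]. apply lt_INR; lia.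
  - apply Rmult_le_reg_r with (INR (S q)); auto. unfold Rdiv.
    rewrite Rmult_assoc, Rinv_l, Rmult_1_l, Rmult_1_r by lra. apply le_INR; lia.
Qed.

Lemma grid_cell q t : 0 <= t <= INR (S q) ->
  exists p, (p <= q)%nat /\ INR p <= t <= INR (S p).
Proof.
  induction q as [|q IH]; intros Ht.
  - exists 0%nat. split; [lia|]. simpl in *; lra.
  - destruct (Rle_dec t (INR (S q))) as [H|H].
    + destruct IH as [p [Hp Hpt]]; [lra|]. exists p. auto.
    + exists (S q). split; [lia|lra].
Qed.

Lemma cell_dense x eps : I01 x -> eps > 0 ->
  exists n, forall y, fst (cell n) <= y <= snd (cell n) -> Rabs (y - x) < eps.
Proof.
  intros Hx Heps. destruct (archimed_cor1 eps Heps) as [q [Hq Hq0]].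
  destruct q as [|q]; [lia|].
  assert (Hpos : 0 < INR (S q)) by (apply lt_0_INR; lia).
  destruct (grid_cell q (x * INR (S q))) as [p [Hp Hpx]]; [unfold I01 in Hx; nra|].
  exists (to_nat (p, q)). unfold cell. rewrite cancel_of_to.
  rewrite (proj2 (Nat.leb_le p q) Hp). cbn [fst snd]. intros y Hy.
  rewrite (S_INR p) in *.
  assert (Hinv : INR (S q) * / INR (S q) = 1) by (apply Rinv_r; lra).
  set (I := / INR (S q)) in *. unfold Rdiv in Hy. fold I in Hy.
  assert (0 < I) by (now apply Rinv_0_lt_compat).
  assert (Ex : x = x * INR (S q) * I) by (rewrite Rmult_assoc, Hinv; ring).
  assert (INR p * I <= x <= (INR p + 1) * I)
    by (rewrite Ex; split; apply Rmult_le_compat_r; lra).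
  apply Rabs_def1; lra.
Qed.

(** * Construction of the scrambled set *)

Theorem theorem7p8 (f : R -> R) :
  maps_I01 f -> continuous_on_I01 f -> mixing f -> f 0 = 0 ->
  exists (eps : R) (S : R -> Prop),
    eps > 0 /\ mycielski S /\ dense_in_I01 S /\
    synd_scrambled f eps (fun x => S x \/ x = 0).
Proof.
  intros Hmaps Hcont Hmix Hf0.
  destruct (stages_exist f Hmaps Hcont Hmix Hf0) as
    [h0 [h1 [b [pre [post [Hh0 [Hh [Hh1 [Hpre [Hmono [Hhit Hstage]]]]]]]]]]].
  pose (good := fun n (i0 : nat) (pt : (nat -> bool) -> R) =>
    (forall w, fst (cell n) <= pt w <= snd (cell n)) /\
    (forall w i, (i0 <= i)%nat ->
       stage_path f b pre post i (w (idx i)) (iter f (start pre post i) (pt w))) /\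
    (forall w eps, eps > 0 -> exists m, forall w',
       (forall k, (k < m)%nat -> w' k = w k) -> Rabs (pt w' - pt w) < eps)).
  assert (Hex : forall n, exists ip, good n (fst ip) (snd ip)).
  { intros n. destruct (cell_I01 n) as [H0 [H1 H2]].
    destruct (itinerary_points f Hmaps Hcont Hmix h0 h1 b pre post Hh Hpre
      Hmono Hhit Hstage (fst (cell n)) (snd (cell n))) as [i0 [pt H]]; auto.
    now exists (i0, pt). }
  pose (ip := fun n => proj1_sig (constructive_indefinite_description _ (Hex n))).
  assert (Hip : forall n, good n (fst (ip n)) (snd (ip n)))
    by (intros n; exact (proj2_sig (constructive_indefinite_description _ (Hex n)))).
  clearbody ip. clear Hex.
  set (x := fun n s => snd (ip n) (word n s)).
  assert (HxI : forall n s, I01 (x n s)).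
  { intros n s. destruct (Hip n) as [H _]. specialize (H (word n s)).
    pose proof (cell_I01 n). unfold x, I01. lra. }
  assert (Hxt : forall n s i, (fst (ip n) <= i)%nat ->
    target (word n s (idx i)) (iter f (b + start pre post i) (x n s))).
  { intros n s i Hi. rewrite iter_add. now apply (Hip n). }
  assert (Hsep : forall n s n' s', (n, s) <> (n', s') -> forall N, exists m,
    (N <= m)%nat /\ 1/4 <= Rabs (iter f m (x n s) - iter f m (x n' s'))).
  { intros n s n' s' Hne N.
    destruct (classic (exists j, word n s j <> word n' s' j)) as [[j Hj]|Hno].
    - destruct (idx_recurs j (N + fst (ip n) + fst (ip n'))) as [i [Hi <-]].
      exists (b + start pre post i)%nat. split.
      + pose proof (start_ge pre post Hpre Hmono i). lia.
      + apply target_separated with (1 := Hj); apply Hxt; lia.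
    - exfalso. destruct (word_inj n s n' s') as [<- <-]; [|now apply Hne].
      intros j. apply NNPP. intros H. apply Hno. now exists j. }
  assert (Haway : forall n s N, exists m,
    (N <= m)%nat /\ 1/4 <= iter f m (x n s)).
  { intros n s N. exists (b + start pre post (N + fst (ip n)))%nat. split.
    - pose proof (start_ge pre post Hpre Hmono (N + fst (ip n))). lia.
    - apply target_bounds with (word n s (idx (N + fst (ip n)))). apply Hxt. lia. }
  (* Orbits separated at some time start from different points; this makes every coding map
     injective. *)
  assert (Hxinj : forall n s n' s', x n s = x n' s' -> (n, s) = (n', s')).
  { intros n s n' s' E. apply NNPP. intros Hne.
    destruct (Hsep n s n' s' Hne 0%nat) as [m [_ Hm]].
    rewrite E, Rminus_diag, Rabs_R0 in Hm. lra. }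
  set (S := fun y => exists n s, x n s = y).
  assert (Hsmall : forall y, S y \/ y = 0 -> I01 y /\ syndetically_small f y).
  { intros y [[n [s <-]]| ->].
    - split; [apply HxI|].
      apply (stage_paths_small f b pre post Hpre Hmono (fun i => word n s (idx i)) _
        (fst (ip n))).
      intros i Hi. now apply (Hip n).
    - split; [unfold I01; lra|]. now apply syndetically_small_0. }
  assert (Hfar : forall y z, S y \/ y = 0 -> S z \/ z = 0 -> y <> z -> forall N, exists m,
    (N <= m)%nat /\ 1/4 <= Rabs (iter f m y - iter f m z)).
  { intros y z [[n [s <-]]| ->] [[n' [s' <-]]| ->] Hne N.
    - apply Hsep. intros E. apply Hne. now injection E as -> ->.
    - destruct (Haway n s N) as [m [Hm H]]. exists m. split; [exact Hm|].
      rewrite iter_fixed0, Rminus_0_r, Rabs_right by (auto; lra). exact H.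
    - destruct (Haway n' s' N) as [m [Hm H]]. exists m. split; [exact Hm|].
      rewrite iter_fixed0, Rminus_0_l, Rabs_Ropp, Rabs_right by (auto; lra). exact H.
    - now elim Hne. }
  (* The constant [1/4] is the gap between the targets and also a lower bound for their distance
     from 0. *)
  exists (1/4), S. split; [lra|]. split; [|split; [|split]].
  - exists (fun n y => exists s, x n s = y). split; [|reflexivity].
    intros n. exists (x n). split; [|split].
    + intros s eps Heps. destruct (Hip n) as [_ [_ H]].
      destruct (H (word n s) eps Heps) as [m Hm]. exists m. intros t Ht.
      apply Hm. now apply word_prefix.
    + intros s t E. now injection (Hxinj n s n t E).
    + reflexivity.
  - split.
    + intros y [n [s <-]]. apply HxI.
    + intros y eps Hy Heps. destruct (cell_dense y eps Hy Heps) as [n Hn].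
      exists (x n (fun _ => true)). split; [now exists n, (fun _ => true)|].
      apply Hn, (Hip n).
  - exists (x 0%nat (fun _ => true)), 0. split; [|split; [now right|]].
    + left. now exists 0%nat, (fun _ => true).
    + intros E. destruct (Haway 0%nat (fun _ => true) 0%nat) as [m [_ Hm]].
      rewrite E, iter_fixed0 in Hm by auto. lra.
  - intros y z Hy Hz Hne. destruct (Hsmall y Hy) as [Iy Sy]. destruct (Hsmall z Hz) as [Iz Sz].
    pose proof (Hfar y z Hy Hz Hne) as Hlim. split; [|split].
    + intros eta Heta. now apply small_pair_syndetic.
    + intros Hcv. destruct (Hcv (1/4)) as [N HN]; [lra|].
      destruct (Hlim N) as [m [Hm H]]. specialize (HN m Hm).
      unfold Rdist in HN. rewrite Rminus_0_r, Rabs_Rabsolu in HN. lra.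
    + intros delta Hdelta N. destruct (Hlim N) as [m [Hm H]]. exists m.
      split; [exact Hm|lra].
Qed.
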